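(* Let $W_{\boldsymbol\lambda}$ be a conditionally positive definite (CPD) unilateral weighted shift with weights $\boldsymbol\lambda=\{\lambda_k\}_{k=0}^\infty$, let $(b,c,\nu)$ be its scalar representing triplet and let $(B,C,F)$ be the representing triplet of the operator $W_{\boldsymbol\lambda}$. Then $B$, $C$ and $F(\varDelta)$, for every Borel set $\varDelta\subseteq\mathbb{R}_+$, are diagonal operators with respect to the standard orthonormal basis $\{e_k\}_{k=0}^\infty$ of $\ell^2$ with diagonal terms $\{b_k\}_{k=0}^\infty$, $\{c_k\}_{k=0}^\infty$ and $\{\nu_k(\varDelta)\}_{k=0}^\infty$, respectively, given by $$b_k=\frac{\hat\lambda_{k+1}-\hat\lambda_k-c}{\hat\lambda_k},\quad c_k=\frac{c}{\hat\lambda_k},\quad \nu_k(\varDelta)=\frac{1}{\hat\lambda_k}\int_{\varDelta}x^k\,d\nu(x).$$ Moreover, the operator $C$ is compact.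
   Context: $\mathbb{Z}_+=\{0,1,2,\dots\}$, $\mathbb{R}_+=[0,\infty)$; scalar measures are positive. The polynomials $Q_n$ are $Q_0=Q_1=0$ and $Q_n(x)=\sum_{j=0}^{n-2}(n-j-1)x^j$ for $n\geq 2$ ($x^0=1$ for all $x$). A real sequence $\{\gamma_n\}_{n=0}^\infty$ is CPD if $\sum_{i,j=0}^k \gamma_{i+j}\alpha_i\bar\alpha_j\geq 0$ for every finite sequence $\alpha_0,\dots,\alpha_k\in\mathbb{C}$ with $\sum_{j=0}^k\alpha_j=0$. A bounded operator $T$ on a complex Hilbert space $\mathcal{H}$ is CPD if $\{\|T^nh\|^2\}_{n=0}^\infty$ is CPD for every $h\in\mathcal{H}$. A semispectral measure on $\mathbb{R}_+$ is a map $F$ from the Borel $\sigma$-algebra of $\mathbb{R}_+$ to the bounded operators on $\mathcal{H}$ such that $\langle F(\cdot)h,h\rangle$ is a (positive) measure for every $h\in\mathcal{H}$. It is known that $T$ is CPD if and only if there are bounded operators $B=B^*$, $C\geq0$ and a compactly supported semispectral measure $F$ on $\mathbb{R}_+$ with $F(\{1\})=0$ such that $T^{*n}T^n=I+nB+n^2C+\int_{\mathbb{R}_+}Q_n(x)\,F(dx)$ for all $n\in\mathbb{Z}_+$; the triplet $(B,C,F)$ is then unique and is called the representing triplet of $T$. For a bounded sequence $\boldsymbol\lambda$ of positive reals, $W_{\boldsymbol\lambda}$ is the bounded operator on $\ell^2$ with $W_{\boldsymbol\lambda}e_n=\lambda_ne_{n+1}$; $\hat\lambda_0=1$ and $\hat\lambda_n=\lambda_0^2\cdots\lambda_{n-1}^2$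 for $n\geq1$. If $W_{\boldsymbol\lambda}$ is CPD, its scalar representing triplet is the unique $(b,c,\nu)$ with $b\in\mathbb{R}$, $c\in\mathbb{R}_+$, $\nu$ a compactly supported finite Borel measure on $\mathbb{R}_+$ with $\nu(\{1\})=0$ and $\hat\lambda_n=1+bn+cn^2+\int_{\mathbb{R}_+}Q_n\,d\nu$ for all $n\in\mathbb{Z}_+$. An operator $T$ is diagonal with diagonal terms $\{\xi_n\}_{n=0}^\infty$ with respect to an orthonormal basis $\{f_n\}_{n=0}^\infty$ if $Tf_n=\xi_nf_n$ for all $n$. *)

(* Defs.v *)
From HB Require Import structures.
From mathcomp Require Import all_boot all_order all_algebra.
From mathcomp Require Import complex ring lra.
From mathcomp Require Import all_classical all_reals all_analysis.

Set Implicit Arguments.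
Unset Strict Implicit.
Unset Printing Implicit Defensive.

Import Order.TTheory GRing.Theory Num.Theory.
Import numFieldNormedType.Exports.
Local Open Scope classical_set_scope.
Local Open Scope complex_scope.
Local Open Scope ring_scope.

Section SquareSummable.
Variable R : realType.
Implicit Types (x y : nat -> R[i]).

Definition sqnorms x : R^nat := fun n => Normc.normc (x n) ^+ 2.

Definition square_summable : {pred (nat -> R[i])} :=
  fun x => `[< cvgn (series (sqnorms x)) >].

Lemma sqnorms_ge0 x n : 0 <= sqnorms x n.
Proof. exact: sqr_ge0. Qed.

Lemma square_summableP x (M : R) :
  (forall n, series (sqnorms x) n <= M) -> x \in square_summable.
Proof.
move=> h; apply/asboolP/nondecreasing_is_cvgn.
  by apply: nondecreasing_series => n _ _; exact: sqnorms_ge0.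
by exists M => _ [n _ <-]; exact: h.
Qed.

Lemma series_sqnorms_le x n : x \in square_summable ->
  series (sqnorms x) n <= limn (series (sqnorms x)).
Proof.
move=> /asboolP h; apply: nondecreasing_cvgn_le => //.
by apply: nondecreasing_series => k _ _; exact: sqnorms_ge0.
Qed.

Lemma normcZ_sqr (a z : R[i]) :
  Normc.normc (a * z) ^+ 2 = Normc.normc a ^+ 2 * Normc.normc z ^+ 2.
Proof. by rewrite Normc.normcM exprMn. Qed.

Lemma sqnormsZ (a : R[i]) x :
  series (sqnorms (a *: x)) = Normc.normc a ^+ 2 *: series (sqnorms x).
Proof.
apply/funext => n; rewrite -[RHS]/(_ * _) /series /= mulr_sumr.
by apply: eq_bigr => k _; rewrite /sqnorms -normcZ_sqr.
Qed.

Lemma minkowski2 (a b s t : R) : 0 <= a -> 0 <= b -> 0 <= s -> 0 <= t ->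
  Num.sqrt ((a + b) ^+ 2 + (s + t) ^+ 2) <=
  Num.sqrt (a ^+ 2 + s ^+ 2) + Num.sqrt (b ^+ 2 + t ^+ 2).
Proof.
move=> a0 b0 s0 t0; have := le_normcD (a +i* s) (b +i* t).
by rewrite /Normc.normc.
Qed.

Lemma sqrt_series_sqnormsD x y n :
  Num.sqrt (series (sqnorms (x + y)) n) <=
  Num.sqrt (series (sqnorms x) n) + Num.sqrt (series (sqnorms y) n).
Proof.
have ge0 z m : 0 <= series (sqnorms z) m
  by apply: sumr_ge0 => k _; exact: sqnorms_ge0.
elim: n => [|n ih]; first by rewrite !seriesEord /= !big_ord0 sqrtr0 addr0.
rewrite !seriesSr.
rewrite -[X in _ <= Num.sqrt (X + _) + _]sqr_sqrtr //.
rewrite -[X in _ <= _ + Num.sqrt (X + _)]sqr_sqrtr //.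
have normc_ge0 (z : R[i]) : 0 <= Normc.normc z
  by case: z => u v; exact: sqrtr_ge0.
apply: le_trans (minkowski2 _ _ _ _); rewrite ?sqrtr_ge0 ?normc_ge0 //.
apply: ler_wsqrtr; apply: lerD.
  by rewrite -[leLHS]sqr_sqrtr // lerXn2r // nnegrE ?addr_ge0 // sqrtr_ge0.
by rewrite lerXn2r // ?nnegrE ?addr_ge0 ?normc_ge0 // le_normcD.
Qed.

Lemma square_summable_submod : submod_closed square_summable.
Proof.
split => [|a x y xs ys].
  apply: (@square_summableP _ 0) => n; rewrite /series /= big1 // => k _.
  by rewrite /sqnorms Normc.normc0 expr0n.
pose A := Num.sqrt (limn (series (sqnorms (a *: x)))).
pose B := Num.sqrt (limn (series (sqnorms y))).
have axs : a *: x \in square_summable.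
  apply/asboolP; rewrite sqnormsZ; apply: is_cvgZr; exact/asboolP.
apply: (@square_summableP _ ((A + B) ^+ 2)) => n.
have ge0 z m : 0 <= series (sqnorms z) m
  by apply: sumr_ge0 => k _; exact: sqnorms_ge0.
rewrite -[leLHS]sqr_sqrtr // lerXn2r ?nnegrE ?addr_ge0 ?sqrtr_ge0 //.
apply: le_trans (sqrt_series_sqnormsD _ _ _) _; apply: lerD;
  exact/ler_wsqrtr/series_sqnorms_le.
Qed.

End SquareSummable.

HB.instance Definition _ (R : realType) :=
  GRing.isSubmodClosed.Build R[i] (nat -> R[i]) (@square_summable R)
    (@square_summable_submod R).

Record ell2 (R : realType) := Ell2 {
  ell2_seq :> nat -> R[i];
  ell2P : ell2_seq \in @square_summable R }.

HB.instance Definition _ (R : realType) := [isSub for @ell2_seq R].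
HB.instance Definition _ (R : realType) := [Choice of ell2 R by <:].
HB.instance Definition _ (R : realType) := [SubChoice_isSubZmodule of ell2 R by <:].
HB.instance Definition _ (R : realType) := [SubZmodule_isSubLmodule of ell2 R by <:].

Section Norm.
Variable R : realType.
Implicit Types (h g : ell2 R).

Definition l2norm h : R := Num.sqrt (limn (series (sqnorms h))).

Lemma l2norm_ge0 h : 0 <= l2norm h.
Proof. exact: sqrtr_ge0. Qed.

Lemma lim_sqnorms_ge0 h : 0 <= limn (series (sqnorms h)).
Proof.
by apply: le_trans (series_sqnorms_le 0 (ell2P h)); rewrite /series /= big_geq.
Qed.

Lemma l2norm_sqr h : l2norm h ^+ 2 = limn (series (sqnorms h)).
Proof. by rewrite sqr_sqrtr // lim_sqnorms_ge0. Qed.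

Lemma series_le_l2norm h n : series (sqnorms h) n <= l2norm h ^+ 2.
Proof. by rewrite l2norm_sqr; apply: series_sqnorms_le; exact: ell2P. Qed.

Lemma normc_le_l2norm h n : Normc.normc (h n) <= l2norm h.
Proof.
have n0 : 0 <= Normc.normc (h n) by case: (h n) => u v; exact: sqrtr_ge0.
rewrite -(@ler_pXn2r _ 2) ?nnegrE ?l2norm_ge0 //.
apply: le_trans (series_le_l2norm h n.+1).
by rewrite seriesSr lerDr sumr_ge0 // => k _; exact: sqnorms_ge0.
Qed.

Lemma l2normD h g : l2norm (h + g) <= l2norm h + l2norm g.
Proof.
rewrite -(@ler_pXn2r _ 2) ?nnegrE ?addr_ge0 ?l2norm_ge0 //.
rewrite l2norm_sqr; apply: limr_le; first exact/asboolP/ell2P.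
near=> n.
have ge0 z m : 0 <= series (@sqnorms R z) m
  by apply: sumr_ge0 => k _; exact: sqnorms_ge0.
rewrite -[leLHS]sqr_sqrtr // lerXn2r ?nnegrE ?addr_ge0 ?l2norm_ge0 ?sqrtr_ge0 //.
apply: le_trans (sqrt_series_sqnormsD _ _ _) _; apply: lerD;
  by apply: ler_wsqrtr; apply: series_sqnorms_le; exact: ell2P.
Unshelve. all: by end_near. Qed.

Lemma l2normZ (a : R[i]) h : l2norm (a *: h) = Normc.normc a * l2norm h.
Proof.
have a0 : 0 <= Normc.normc a by case: a => u v; exact: sqrtr_ge0.
apply/eqP; rewrite -(@eqrXn2 _ 2) ?mulr_ge0 ?l2norm_ge0 //; apply/eqP.
rewrite exprMn !l2norm_sqr sqnormsZ; apply: cvg_lim => //.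
by apply: cvgZr; exact/asboolP/ell2P.
Qed.

Lemma l2norm_eq0 h : l2norm h = 0 -> h = 0.
Proof.
move=> h0; apply/val_inj/funext => n /=; apply: Normc.eq0_normc.
apply/eqP; rewrite eq_le -[X in _ <= X]h0 normc_le_l2norm /=.
by case: (h n) => u v; exact: sqrtr_ge0.
Qed.

(* A normedModType R[i] has its norm in R[i]; l2norm is the real-valued one. *)
Let normC h : R[i] := (l2norm h)%:C.

Lemma normCD h g : normC (h + g) <= normC h + normC g.
Proof. by rewrite -rmorphD /= lecR l2normD. Qed.

Lemma normCZ (a : R[i]) h : normC (a *: h) = `|a| * normC h.
Proof. by rewrite /normC l2normZ rmorphM. Qed.

Lemma normC_eq0 h : normC h = 0 -> h = 0.
Proof. by move=> /complexI /l2norm_eq0. Qed.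

HB.instance Definition _ :=
  @Lmodule_isNormed.Build R[i] (ell2 R) normC normCD normCZ normC_eq0.

Lemma l2normE h : `|h| = (l2norm h)%:C.
Proof. by []. Qed.

End Norm.

Section InnerProduct.
Variable R : realType.
Implicit Types (h g : ell2 R) (z : nat -> R[i]).

(* Sum of a complex series, taken on real and imaginary parts. *)
Definition csum z : R[i] :=
  limn (series (fun n => complex.Re (z n)))
    +i* limn (series (fun n => complex.Im (z n))).

(* Linear in the first argument. *)
Definition dot h g : R[i] := csum (fun n => h n * (g n)^*%C).

Lemma is_cvg_dot (f : R[i] -> R) h g : (forall c : R[i], `|f c| <= Normc.normc c) ->
  cvgn (series (fun n => f (h n * (g n)^*%C))).
Proof.
move=> fle; apply: normed_cvg.
have hg : cvgn (series (fun n => sqnorms h n + sqnorms g n)).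
  rewrite (_ : series _ = series (sqnorms h) + series (sqnorms g)).
    by apply: is_cvgD; exact/asboolP/ell2P.
  by apply/funext => n; rewrite /series /= big_split.
apply: (series_le_cvg _ _ _ hg) => n //=.
  by rewrite addr_ge0 // sqnorms_ge0.
apply: le_trans (fle _) _; rewrite Normc.normcM.
have -> : Normc.normc (g n)^*%C = Normc.normc (g n).
  by case: (g n) => u v; rewrite /= sqrrN.
rewrite /sqnorms; set a := Normc.normc _; set b := Normc.normc _.
have := sqr_ge0 (a - b); have := sqr_ge0 (a + b).
by rewrite sqrrB sqrrD; lra.
Qed.

Lemma Re_le_normc (z : R[i]) : `|complex.Re z| <= Normc.normc z.
Proof.
by case: z => u v /=; rewrite -sqrtr_sqr ler_wsqrtr // lerDl sqr_ge0.
Qed.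

Lemma Im_le_normc (z : R[i]) : `|complex.Im z| <= Normc.normc z.
Proof.
by case: z => u v /=; rewrite -sqrtr_sqr ler_wsqrtr // lerDr sqr_ge0.
Qed.

Lemma dotC h g : dot g h = (dot h g)^*%C.
Proof.
rewrite /dot /csum /=; congr (_ +i* _).
  congr (limn (series _)); apply/funext => n.
  by case: (h n) (g n) => a b [c d] /=; ring.
rewrite -limN; last exact: (is_cvg_dot Im_le_normc).
congr (limn _); apply/funext => n; rewrite -[RHS]/(- _) /series /= -sumrN.
by apply: eq_bigr => k _; case: (h k) (g k) => a b [c d] /=; ring.
Qed.

Lemma dotDl h1 h2 g : dot (h1 + h2) g = dot h1 g + dot h2 g.
Proof.
rewrite /dot /csum /=; apply/eqP; rewrite eq_complex /=; apply/andP; split;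
  apply/eqP.
  rewrite -limD; do ?exact: (is_cvg_dot Re_le_normc).
  congr (limn _); apply/funext => n; rewrite -[RHS]/(_ + _) /series /= -big_split /=.
  apply: eq_bigr => k _; rewrite -[X in complex.Re (X * _)]/(h1 k + h2 k) mulrDl.
  by case: (h1 k * _) (h2 k * _) => a b [c d].
rewrite -limD; do ?exact: (is_cvg_dot Im_le_normc).
congr (limn _); apply/funext => n; rewrite -[RHS]/(_ + _) /series /= -big_split /=.
apply: eq_bigr => k _; rewrite -[X in complex.Im (X * _)]/(h1 k + h2 k) mulrDl.
by case: (h1 k * _) (h2 k * _) => a b [c d].
Qed.

Lemma dotZl (a : R[i]) h g : dot (a *: h) g = a * dot h g.
Proof.
have cvR := @is_cvg_dot _ h g Re_le_normc; have cvI := @is_cvg_dot _ h g Im_le_normc.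
case: a => a b; rewrite /dot /csum /=.
set S := series _ in cvR *; set T := series _ in cvI *.
have ReE : series (fun n => complex.Re ((a +i* b *: h : ell2 R) n * (g n)^*%C)) =
    (fun n => a * S n - b * T n).
  apply/funext => n; rewrite /S /T /series /= !mulr_sumr -sumrB.
  apply: eq_bigr => k _; rewrite -[X in complex.Re (X * _)]/(_ * h k).
  by case: (h k) (g k) => u v [s t] /=; ring.
have ImE : series (fun n => complex.Im ((a +i* b *: h : ell2 R) n * (g n)^*%C)) =
    (fun n => a * T n + b * S n).
  apply/funext => n; rewrite /S /T /series /= !mulr_sumr -big_split /=.
  apply: eq_bigr => k _; rewrite -[X in complex.Im (X * _)]/(_ * h k).
  by case: (h k) (g k) => u v [s t] /=; ring.
rewrite ReE ImE; congr (_ +i* _); apply: cvg_lim => //.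
  by apply: cvgB; apply: cvgMl_tmp.
by apply: cvgD; apply: cvgMl_tmp.
Qed.

Lemma dot_l2norm h : dot h h = (l2norm h ^+ 2)%:C.
Proof.
rewrite l2norm_sqr /dot /csum /=; congr (_ +i* _).
  congr (limn (series _)); apply/funext => n; rewrite /sqnorms.
  case: (h n) => a b /=; rewrite sqr_sqrtr ?addr_ge0 ?sqr_ge0 //.
  by ring.
apply: cvg_lim => //.
rewrite (_ : series _ = cst 0); first exact: cvg_cst.
apply/funext => n; rewrite /series /= big1 // => k _.
by case: (h k) => a b /=; ring.
Qed.

End InnerProduct.

Section Basis.
Variable R : realType.

Lemma l2basis_summable (k : nat) :
  (fun n => (n == k)%:R) \in @square_summable R.
Proof.
apply: (@square_summableP _ _ 1) => n; rewrite /series /=.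
have -> : \sum_(0 <= i < n) sqnorms (fun n => (n == k)%:R : R[i]) i =
          \sum_(0 <= i < n) (i == k)%:R.
  apply: eq_bigr => i _; rewrite /sqnorms; case: (_ == _).
    by rewrite Normc.normc1 expr1n.
  by rewrite Normc.normc0 expr0n.
rewrite -natr_sum -big_mkcond /= -(big_filter _ (pred1 k)) sum1_size.
by rewrite lern1 size_filter count_uniq_mem ?iota_uniq // leq_b1.
Qed.

Definition l2basis k : ell2 R := Ell2 (l2basis_summable k).

Variables (lambda : nat -> R).
Hypothesis lambda_bounded : exists M, forall n, `|lambda n| <= M.

Definition wshift_seq (x : nat -> R[i]) : nat -> R[i] :=
  fun n => if n is m.+1 then (lambda m)%:C * x m else 0.

Lemma wshift_summable (h : ell2 R) : wshift_seq h \in @square_summable R.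
Proof.
have [M lM] := lambda_bounded.
have M0 : 0 <= M := le_trans (normr_ge0 _) (lM 0%N).
apply: (@square_summableP _ _ (M ^+ 2 * l2norm h ^+ 2)) => -[|n].
  by rewrite /series /= big_geq // mulr_ge0 // sqr_ge0.
rewrite /series /= big_nat_recl //.
have -> : sqnorms (wshift_seq h) 0 = 0.
  by rewrite /sqnorms /wshift_seq Normc.normc0 expr0n.
rewrite add0r.
apply: le_trans (ler_wpM2l (sqr_ge0 M) (series_le_l2norm h n)).
rewrite /series /= mulr_sumr ler_sum // => k _.
rewrite /sqnorms /wshift_seq normcZ_sqr ler_wpM2r ?sqr_ge0 //.
by rewrite /= expr0n addr0 sqrtr_sqr lerXn2r ?nnegrE.
Qed.

Definition wshift (h : ell2 R) : ell2 R := Ell2 (wshift_summable h).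

Lemma wshift_basis k : wshift (l2basis k) = (lambda k)%:C *: l2basis k.+1.
Proof.
apply/val_inj/funext => -[|n] /=; first by rewrite -[RHS]/(_ * 0) mulr0.
rewrite -[RHS]/(_ * (n.+1 == k.+1)%:R) eqSS.
by case: eqP => [->|_]//; rewrite !mulr0.
Qed.

End Basis.

Section ConditionallyPositiveDefinite.
Variable R : realType.
Local Notation H := (ell2 R).
Implicit Types (T S A B C : H -> H) (F : set R -> H -> H).

Definition bounded_operator T :=
  linear T /\ exists M : R, forall h, l2norm (T h) <= M * l2norm h.

Definition is_adjoint T S :=
  bounded_operator S /\ forall h g, dot (T h) g = dot h (S g).

(* The order of R[i] is the partial one: 0 <= z means that z is real and
   nonnegative. *)
Definition positive_operator T := forall h, 0 <= dot (T h) h.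

Definition compact_operator T :=
  bounded_operator T /\ compact (closure (T @` [set h | `|h| <= 1])).

Definition diagonal_operator T (xi : nat -> R[i]) :=
  bounded_operator T /\ forall k, T (l2basis R k) = xi k *: l2basis R k.

Definition CPD_seq (gamma : nat -> R) :=
  forall k (alpha : 'I_k.+1 -> R[i]), \sum_j alpha j = 0 ->
    0 <= \sum_(i < k.+1) \sum_(j < k.+1)
      (gamma (i + j)%N)%:C * alpha i * (alpha j)^*%C.

Definition CPD_operator T :=
  bounded_operator T /\ forall h, CPD_seq (fun n => l2norm (iter n T h) ^+ 2).

(* The zero polynomial for n = 0 and n = 1; otherwise j < n.-1 makes the
   truncated subtraction exact. *)
Definition Q n : {poly R} := \poly_(j < n.-1) (n - j - 1)%N%:R.

(* Borel measures on the half-line are encoded as Borel measures on R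
   vanishing off it; the same is done for semispectral measures. *)
Definition Rplus : set R := `[0, +oo[%classic.

Definition compactly_supported (mu : set R -> \bar R) :=
  exists K, [/\ compact K, K `<=` Rplus & mu (~` K) = 0%E].

(* mu is the measure <F(.)h, h>. *)
Definition quad_measure F h (mu : {finite_measure set R -> \bar R}) :=
  forall D, measurable D -> dot (F D h) h = (fine (mu D))%:C.

Definition semispectral F :=
  [/\ forall D, measurable D -> bounded_operator (F D),
      forall h, exists mu, quad_measure F h mu &
      forall h, F (~` Rplus) h = 0].

Definition compactly_supported_op F :=
  exists K, [/\ compact K, K `<=` Rplus & forall h, F (~` K) h = 0].

(* A is the integral of f over the half-line with respect to F, characterized
   by its quadratic form. *)
Definition is_op_integral F (f : R -> R) A :=
  bounded_operator A /\
  forall h mu, quad_measure F h mu ->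
    dot (A h) h = (\int[mu]_(x in Rplus) f x)%:C.

Record representing_triplet T B C F : Prop := {
  rt_bounded_B : bounded_operator B;
  rt_selfadjoint_B : is_adjoint B B;
  rt_bounded_C : bounded_operator C;
  rt_positive_C : positive_operator C;
  rt_semispectral : semispectral F;
  rt_support : compactly_supported_op F;
  rt_one : forall h, F [set 1] h = 0;
  rt_formula : exists2 S, is_adjoint T S &
    forall n, exists2 A, is_op_integral F (horner (Q n)) A &
      forall h, iter n S (iter n T h) =
        h + n%:R *: B h + (n ^ 2)%:R *: C h + A h }.

Definition lambda_hat (lambda : nat -> R) n := \prod_(j < n) lambda j ^+ 2.

Record scalar_representing_triplet (lambda : nat -> R) (b c : R)
    (nu : {finite_measure set R -> \bar R}) : Prop := {
  srt_ge0 : 0 <= c;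
  srt_support : compactly_supported nu;
  srt_one : nu [set 1] = 0%E;
  srt_formula : forall n, lambda_hat lambda n =
    1 + b * n%:R + c * n%:R ^+ 2 + \int[nu]_(x in Rplus) (Q n).[x] }.

End ConditionallyPositiveDefinite.

(* Main.v *)
From HB Require Import structures.
Require Import Defs.
From mathcomp Require Import all_boot all_order all_algebra.
From mathcomp Require Import complex ring lra zify.
From mathcomp Require Import all_classical all_reals all_analysis.
From mathcomp Require Import measurable_realfun.

Import Order.TTheory GRing.Theory Num.Theory.
Import numFieldNormedType.Exports.
Local Open Scope classical_set_scope.
Local Open Scope complex_scope.
Local Open Scope ring_scope.

(** The representing data of a conditionally positive definite sequence are
    determined by the sequence.  If u_n = u_0 + b n + c n^2 + \int Q_n dmu,
    then, since Q_(n+2) - 2 Q_(n+1) + Q_n = x^n, the second difference of u is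
    the moment sequence of the measure mu + 2 c delta_1.  A compactly supported
    measure is determined by its moments, and mu has no mass at 1, so both c
    and mu can be read off from u; u_1 = u_0 + b + c then gives b.

    For every vector h, pairing the formula for W^*n W^n with h shows that
    u_n = ||W^n h||^2 is such a sequence, with data <B h, h>, <C h, h> and
    <F(.) h, h> (quad_cpd_representation).  Two choices of h give everything.

    - h = e_k.  Here u_n = lhat_(n+k) / lhat_k, so the moments of the measure of
      u are those of the measure of lhat, shifted by k and divided by lhat_k:
      the measure of u is x^k nu / lhat_k together with the atom
      2 c / lhat_k delta_1 (cpd_representation_shift).  These are the diagonal
      terms.

    - h = e_k + z e_j with j <> k.  The number ||W^n h|| depends on the moduli of
      the coordinates of h only (l2norm_iter_wshift_modulus), so the vectors
      e_k + z e_j and e_k - z e_j have the same data.  As z is arbitrary,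
      polarization makes the off-diagonal entries vanish (form_eq0).

    Moments determine a measure on a segment because the polynomials
    1 - (1 - y^(2 n))^(k_n), with k_n close to t^(-2 n) / (n + 1), stay between 0
    and 1 on [0, 1] and converge pointwise to the indicator of ]t, 1]; this
    follows from Bernoulli's inequality.  By dominated convergence the measures
    of all half-lines are limits of linear combinations of moments.

    Compactness of C: if c = 0 then C = 0.  If c > 0, then Q_n >= 0 on the
    half-line gives lhat_n >= 1 + b n + c n^2, so the diagonal terms c / lhat_n
    are square summable and C maps the unit ball into a Hilbert cube, which is
    compact (hilbert_cube_compact). *)

(** * Polynomial approximation of step functions *)

Section Step.
Set Implicit Arguments.
Unset Strict Implicit.
Variable R : realType.
Implicit Types t y : R.

Lemma bernoulli_ge y k : 0 <= y <= 1 -> 1 - k%:R * y <= (1 - y) ^+ k.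
Proof.
case/andP=> y0 y1; elim: k => [|k ih]; first by rewrite mul0r subr0 expr0.
rewrite exprS; apply: (@le_trans _ _ ((1 - y) * (1 - k%:R * y))).
  rewrite -natr1; have : 0 <= k%:R * y ^+ 2 by rewrite mulr_ge0 ?ler0n ?sqr_ge0.
  lra.
by rewrite ler_wpM2l // subr_ge0.
Qed.

Lemma bernoulli_le y k : 0 <= y <= 1 -> (1 - y) ^+ k * (1 + k%:R * y) <= 1.
Proof.
case/andP=> y0 y1; elim: k => [|k ih]; first by rewrite mul0r addr0 expr0 mulr1.
apply: le_trans ih; rewrite exprS -natr1 mulrC mulrA mulrC ler_wpM2l //.
  by rewrite exprn_ge0 // subr_ge0.
have : 0 <= k%:R * y ^+ 2 by rewrite mulr_ge0 ?ler0n ?sqr_ge0.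
have := sqr_ge0 y; lra.
Qed.

Lemma bernoulli_exp y k : 0 <= y -> 1 + k%:R * y <= (1 + y) ^+ k.
Proof.
move=> y0; elim: k => [|k ih]; first by rewrite mul0r addr0 expr0.
rewrite exprS; apply: (@le_trans _ _ ((1 + y) * (1 + k%:R * y))).
  rewrite -natr1; have : 0 <= k%:R * y ^+ 2 by rewrite mulr_ge0 ?ler0n ?sqr_ge0.
  lra.
by rewrite ler_wpM2l // addr_ge0.
Qed.

(** Up to rounding, step_exponent t n * y ^ (2 n) is (y / t) ^ (2 n) / (n + 1).
    It tends to 0 for y <= t, the endpoint included, because of the factor
    1 / (n + 1), and to infinity for y > t.  With the even exponent 2 n the
    latter follows from the square of a linear lower bound for (y / t) ^ n. *)
Definition step_exponent t n := Num.truncn (t^-1 ^+ n.*2 / n.+1%:R).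

Definition step_poly t n : {poly R} := 1 - (1 - 'X^(n.*2)) ^+ step_exponent t n.

Lemma step_polyE t n y :
  (step_poly t n).[y] = 1 - (1 - y ^+ n.*2) ^+ step_exponent t n.
Proof. by rewrite /step_poly !hornerE. Qed.

Lemma step_poly_itv t n y : 0 <= y <= 1 -> 0 <= (step_poly t n).[y] <= 1.
Proof.
move=> /andP[y0 y1]; rewrite step_polyE.
have yn0 : 0 <= y ^+ n.*2 by rewrite exprn_ge0.
have yn1 : y ^+ n.*2 <= 1 by rewrite exprn_ile1.
have a0 : 0 <= (1 - y ^+ n.*2) ^+ step_exponent t n by rewrite exprn_ge0 // subr_ge0.
have a1 : (1 - y ^+ n.*2) ^+ step_exponent t n <= 1.
  by rewrite exprn_ile1 ?subr_ge0 // gerBl.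
lra.
Qed.

(** From (1 - x)^k >= 1 - k x with x = y^(2 n), where k x <= 1 / (n + 1). *)
Lemma step_poly_le t n y : 0 < t -> 0 <= y <= 1 -> y <= t ->
  (step_poly t n).[y] <= n.+1%:R^-1.
Proof.
move=> t0 /andP[y0 y1] yt; rewrite step_polyE lerBlDr -lerBlDl.
have yn : 0 <= y ^+ n.*2 <= 1 by rewrite exprn_ge0 //= exprn_ile1.
apply: le_trans (bernoulli_ge _ yn); rewrite lerD2l lerN2.
have k0 : 0 <= t^-1 ^+ n.*2 / n.+1%:R.
  by rewrite divr_ge0 ?exprn_ge0 ?invr_ge0 ?(ltW t0).
have /andP[kle _] := truncn_itv k0.
case/andP: yn => yn0 yn1.
apply: le_trans (ler_wpM2r yn0 kle) _.
rewrite mulrAC -exprMn ler_piMl // exprn_ile1 //.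
  by rewrite mulr_ge0 // invr_ge0 ltW.
by rewrite mulrC ler_pdivrMr // mul1r.
Qed.

(** From (1 - x)^k <= 1 / (1 + k x) with x = y^(2 n), where k x + 1 is at least
    (1 + d)^(2 n) / (n + 1), hence at least d^2 (n + 1). *)
Lemma step_poly_ge t d n y : 0 < t -> 0 < d <= 1 -> 0 <= y <= 1 ->
  (1 + d) * t <= y -> 1 - (d ^+ 2 * n.+1%:R)^-1 <= (step_poly t n).[y].
Proof.
move=> t0 /andP[d0 d1] /andP[y0 y1] ty; rewrite step_polyE lerD2l lerN2.
have yn : 0 <= y ^+ n.*2 <= 1 by rewrite exprn_ge0 //= exprn_ile1.
have := bernoulli_le (step_exponent t n) yn; case/andP: yn => yn0 yn1.
have k0 : 0 <= t^-1 ^+ n.*2 / n.+1%:R.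
  by rewrite divr_ge0 ?exprn_ge0 ?invr_ge0 ?(ltW t0).
have /andP[_ klt] := truncn_itv k0.
set k := step_exponent t n; set q := (1 - _) ^+ k => qle.
have q0 : 0 <= q by rewrite exprn_ge0 // subr_ge0.
have D0 : 0 < d ^+ 2 * n.+1%:R by rewrite mulr_gt0 ?exprn_gt0 // ltr0Sn.
rewrite -[leRHS]mul1r ler_pdivlMr //; apply: le_trans qle.
rewrite ler_wpM2l //.
have kyn : t^-1 ^+ n.*2 / n.+1%:R * y ^+ n.*2 <= 1 + k%:R * y ^+ n.*2.
  apply: le_trans (ler_wpM2r yn0 (ltW klt)) _.
  by rewrite -natr1 mulrDl mul1r addrC lerD2r.
apply: le_trans kyn; rewrite [leRHS]mulrAC -exprMn ler_pdivlMr ?ltr0Sn //.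
have h : (1 + d) <= t^-1 * y by rewrite mulrC ler_pdivlMr.
(* Bernoulli applied to (1 + d)^n and then squared: one factor n + 1 of
   (1 + n d)^2 is left after the division. *)
have e : d ^+ 2 * n.+1%:R * n.+1%:R = (d * n.+1%:R) ^+ 2 :> R by ring.
have ty0 : 0 <= t^-1 * y by rewrite mulr_ge0 // invr_ge0 ltW.
have d0' := ltW d0.
rewrite e -muln2 exprM lerXn2r ?nnegrE ?mulr_ge0 ?exprn_ge0 //.
apply: (@le_trans _ _ ((1 + d) ^+ n)).
  by apply: le_trans (bernoulli_exp n d0'); rewrite -natr1; lra.
by rewrite lerXn2r // nnegrE ?addr_ge0.
Qed.

Lemma step_poly_cvg t y : 0 < t -> 0 <= y <= 1 ->
  (step_poly t n).[y] @[n --> \oo] --> ((t < y)%R%:R : R).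
Proof.
move=> t0 y01.
have h0 : (n.+1%:R^-1 : R) @[n --> \oo] --> 0 by exact: cvg_harmonic.
case: (ltP t y) => [ty|yt]; last first.
  apply: (@squeeze_cvgr _ _ _ _ (cst 0) (fun n => n.+1%:R^-1)) => //.
    apply: nearW => n; rewrite step_poly_le // andbT.
    by case/andP: (@step_poly_itv t n y y01).
  exact: cvg_cst.
(* The cut at 1 is the condition d <= 1 under which 1 + n d >= d (n + 1). *)
pose d := Num.min 1 (y / t - 1).
have d0 : 0 < d by rewrite lt_min ltr01 subr_gt0 ltr_pdivlMr // mul1r.
have d1 : d <= 1 by rewrite ge_min lexx.
have dy : (1 + d) * t <= y.
  rewrite -ler_pdivlMr // -lerBrDl ge_min; apply/orP; right; exact: lexx.
apply: (@squeeze_cvgr _ _ _ _ (fun n => 1 - (d ^+ 2 * n.+1%:R)^-1) (cst 1)).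
- apply: nearW => n; rewrite step_poly_ge // ?d0 //=.
  by case/andP: (@step_poly_itv t n y y01).
- have h1 : (d ^+ 2)^-1 * n.+1%:R^-1 @[n --> \oo] --> (d ^+ 2)^-1 * 0.
    exact: cvgMl_tmp.
  rewrite mulr0 in h1; rewrite -[X in _ --> X]subr0.
  apply: cvgB; first exact: cvg_cst.
  by under eq_fun do rewrite invfM.
- exact: cvg_cst.
Qed.

End Step.

(** * Moments determine a compactly supported measure *)

Section Density.
Set Implicit Arguments.
Unset Strict Implicit.
Context d (T : measurableType d) (R : realType).
Variables (m : {measure set T -> \bar R}) (w : T -> R).
Hypotheses (mw : measurable_fun setT w) (w0 : forall x, 0 <= w x).

(** The two proofs are arguments so that the measure structure below can be
    attached to the head constant. *)
Definition density_measure (_ : measurable_fun setT w) (_ : forall x, 0 <= w x)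
  (D : set T) : \bar R := (\int[m]_(x in D) (w x)%:E)%E.

Local Notation dens := (density_measure mw w0).

Let dens0 : dens set0 = 0%E. Proof. exact: integral_set0. Qed.

Let dens_ge0 D : (0 <= dens D)%E.
Proof. by apply: integral_ge0 => x _; rewrite lee_fin. Qed.

Let dens_sigma_additive : semi_sigma_additive dens.
Proof.
apply: semi_sigma_additive_nng_induced => [|x]; last by rewrite lee_fin.
exact/measurable_EFinP.
Qed.

HB.instance Definition _ := isMeasure.Build _ _ _ dens
  dens0 dens_ge0 dens_sigma_additive.

End Density.

Section WeightedMoments.
Set Implicit Arguments.
Unset Strict Implicit.
Variable R : realType.
Variables (m : {measure set R -> \bar R}) (w : R -> R) (M : R).
Hypotheses (M0 : 0 <= M) (mfin : (m setT < +oo)%E) (mK : m (~` `[0, M]) = 0%E).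
Hypotheses (cw : continuous w) (w0 : forall x, 0 <= w x).

Let K : set R := `[0, M].

Let mItv : measurable K. Proof. exact: measurable_itv. Qed.

Let mw : measurable_fun setT w := continuous_measurable_fun cw.

Lemma finite_measureS D : measurable D -> (m D < +oo)%E.
Proof.
by move=> mD; apply: le_lt_trans mfin; apply: le_measure; rewrite ?inE.
Qed.

Lemma continuous_integrable (f : R -> R) :
  continuous f -> m.-integrable K (EFin \o f).
Proof.
move=> cf; apply: measurable_bounded_integrable => //.
- exact: finite_measureS.
- by apply: measurable_funTS; exact: continuous_measurable_fun.
- have : compact (f @` K).
    apply: continuous_compact; last exact: segment_compact.
    exact: continuous_subspaceT.
  move=> /compact_bounded [N [Nr hN]]; exists N; split => // N' NN' x Kx.
  by apply: (hN N' NN'); exists x.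
Qed.

Lemma integrable_supported D (f : R -> R) : measurable D -> continuous f ->
  m.-integrable D (EFin \o f).
Proof.
move=> mD cf.
have mKc : measurable (~` K) by exact: measurableC.
have mf : measurable_fun D (EFin \o f).
  by apply/measurable_EFinP; apply: measurable_funTS; exact: continuous_measurable_fun.
apply/(negligible_integrable mKc mD mf mK).
rewrite setDE setCK; apply: integrableS (continuous_integrable cf) => //; exact: measurableI.
Qed.

Lemma Rintegral_supported D (f : R -> R) : measurable D -> K `<=` D ->
  continuous f -> \int[m]_(x in D) f x = \int[m]_(x in K) f x.
Proof.
move=> mD KD cf; congr fine.
have mKc : measurable (~` K) by exact: measurableC.
rewrite (negligible_integral mKc mD (integrable_supported mD cf) mK).
by rewrite setDE setCK setIidr.
Qed.

(** The affine map sending -1 to 0 and M + 1 to 1: the segment [0, M] lands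
    strictly inside the unit interval, so that a threshold slightly below 0
    still becomes a positive one. *)
Definition unit_rescale : {poly R} := (M + 2)^-1 *: ('X + 1).

Lemma unit_rescaleE x : unit_rescale.[x] = (x + 1) / (M + 2).
Proof. by rewrite /unit_rescale !hornerE mulrC. Qed.

(** On [0, M] all negative thresholds cut off nothing, so they may be raised to
    -1/2, which the rescaling makes positive. *)
Definition step_at t n : {poly R} :=
  step_poly ((Num.max t (- 2^-1) + 1) / (M + 2)) n \Po unit_rescale.

Lemma step_at_cvg t x : K x ->
  (step_at t n).[x] @[n --> \oo] --> (\1_`]t, +oo[ x : R).
Proof.
rewrite /K /= in_itv /= => /andP[x0 xM].
have M2 : 0 < M + 2 by rewrite ltr_wpDl.
rewrite /step_at; under eq_fun do rewrite horner_comp unit_rescaleE.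
rewrite indicE.
have -> : (x \in `]t, +oo[%classic) =
    ((Num.max t (- 2^-1) + 1) / (M + 2) < (x + 1) / (M + 2)).
  rewrite ltr_pM2r ?invr_gt0 // ltrD2r gt_max.
  have -> : - 2^-1 < x by apply: lt_le_trans x0; rewrite oppr_lt0 invr_gt0.
  by rewrite andbT; apply/idP/idP; rewrite inE /= in_itv /= andbT.
apply: step_poly_cvg.
  rewrite divr_gt0 //; apply: (@lt_le_trans _ _ (- 2^-1 + 1)); first by lra.
  by rewrite lerD2r le_max lexx orbT.
rewrite divr_ge0 ?(ltW M2) ?addr_ge0 //= ler_pdivrMr // mul1r; lra.
Qed.

Lemma step_at_itv t n x : K x -> 0 <= (step_at t n).[x] <= 1.
Proof.
rewrite /K /= in_itv /= => /andP[x0 xM]; have M2 : 0 < M + 2 by rewrite ltr_wpDl.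
rewrite /step_at horner_comp unit_rescaleE; apply: step_poly_itv.
rewrite divr_ge0 ?(ltW M2) ?addr_ge0 //= ler_pdivrMr // mul1r; lra.
Qed.

(** Dominated convergence with the weight itself as the bound. *)
Lemma step_at_integral_cvg t :
  \int[m]_(x in K) ((step_at t n).[x] * w x) @[n --> \oo] -->
  fine (density_measure m mw w0 `]t, +oo[).
Proof.
have mKc : measurable (~` K) by exact: measurableC.
have mt : measurable (`]t, +oo[%classic : set R) by exact: measurable_itv.
have cp n : continuous (fun x => (step_at t n).[x] * w x).
  by move=> x; apply: cvgM; [exact: continuous_horner | exact: cw].
have iw : m.-integrable K (EFin \o w) by exact: continuous_integrable.
have -> : density_measure m mw w0 `]t, +oo[ =
    (\int[m]_(x in K) (\1_`]t, +oo[ x * w x)%:E)%E.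
  rewrite /density_measure (negligible_integral mKc mt _ mK); last first.
    exact: integrable_supported.
  rewrite setDE setCK setIC integral_mkcondr; apply: eq_integral => x _.
  rewrite /patch indicE; case: ifP => _; by rewrite ?mul1r ?mul0r.
apply: fine_cvg; rewrite fineK; last first.
  apply: integrable_fin_num => //.
  apply: le_integrable iw => //.
    apply/measurable_EFinP; apply: measurable_funM; last exact: measurable_funTS.
    by apply: measurable_indic.
  move=> x _ /=; rewrite lee_fin normrM ler_piMl // indicE.
  by case: (_ \in _); rewrite ?normr1 ?normr0.
apply: (@dominated_cvg _ _ _ m K _ _ _ (EFin \o w)) => //=.
- move=> n; apply/measurable_EFinP; apply: measurable_funTS.
  exact: continuous_measurable_fun.
- move=> x Kx; apply: cvg_EFin; first exact: nearW.
  by apply: cvgMr_tmp; exact: step_at_cvg.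
- by move=> n x Kx; rewrite lee_fin normrM (ger0_norm (w0 x)) ler_piMl //;
     have /andP[p0 p1] := step_at_itv t n Kx; rewrite ger0_norm.
Qed.

Lemma density_measure_finite D : measurable D -> (density_measure m mw w0 D < +oo)%E.
Proof.
move=> mD; have := integrable_fin_num mD (integrable_supported mD cw).
by rewrite ge0_fin_numE // integral_ge0 // => x _; rewrite lee_fin.
Qed.

End WeightedMoments.

Section MomentUniqueness.
Set Implicit Arguments.
Unset Strict Implicit.
Variable R : realType.
Variables (m1 m2 : {measure set R -> \bar R}) (w1 w2 : R -> R) (M : R).
Hypotheses (M0 : 0 <= M).
Hypotheses (fin1 : (m1 setT < +oo)%E) (fin2 : (m2 setT < +oo)%E).
Hypotheses (m1K : m1 (~` `[0, M]) = 0%E) (m2K : m2 (~` `[0, M]) = 0%E).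
Hypotheses (cw1 : continuous w1) (cw2 : continuous w2).
Hypotheses (w1_ge0 : forall x, 0 <= w1 x) (w2_ge0 : forall x, 0 <= w2 x).
Hypothesis moments : forall n,
  \int[m1]_(x in `[0, M]) (x ^+ n * w1 x) = \int[m2]_(x in `[0, M]) (x ^+ n * w2 x).

(** The induction multiplies by X, which the power of x absorbs only if it is
    left general. *)
Lemma weighted_poly_integral (p : {poly R}) :
  \int[m1]_(x in `[0, M]) (p.[x] * w1 x) = \int[m2]_(x in `[0, M]) (p.[x] * w2 x).
Proof.
suff h : forall j, \int[m1]_(x in `[0, M]) (x ^+ j * p.[x] * w1 x) =
                   \int[m2]_(x in `[0, M]) (x ^+ j * p.[x] * w2 x).
  by have := h 0%N; under eq_Rintegral do rewrite expr0 mul1r;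
     under [in RHS]eq_Rintegral do rewrite expr0 mul1r.
elim/poly_ind: p => [|p c ih] j.
  rewrite !(@eq_Rintegral _ _ _ _ _ (cst 0)) ?Rintegral_cst ?mul0r //;
    by move=> x _; rewrite horner0 mulr0 mul0r.
have cX (w : R -> R) i (q : {poly R}) : continuous w ->
    continuous (fun x : R => x ^+ i * q.[x] * w x).
  move=> cw x; apply: cvgM; last exact: cw.
  by apply: cvgM; [exact: exprn_continuous | exact: continuous_horner].
have cM (w : R -> R) : continuous w -> continuous (fun x : R => c * (x ^+ j * w x)).
  move=> cw x; apply: cvgMl_tmp; apply: cvgM; last exact: cw.
  exact: exprn_continuous.
have cN (w : R -> R) : continuous w -> continuous (fun x : R => (x ^+ j * w x)).
  move=> cw x; apply: cvgM; last exact: cw.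
  exact: exprn_continuous.
have E (w : R -> R) : (fun x => x ^+ j * (p * 'X + c%:P).[x] * w x) =
    (fun x => x ^+ j.+1 * p.[x] * w x + c * (x ^+ j * w x)).
  apply/funext => x; rewrite hornerD hornerMX hornerC exprSr; ring.
rewrite !E !RintegralD //; try exact: measurable_itv;
  try (apply: continuous_integrable => //; (exact: cX || exact: cM)).
rewrite ih !RintegralZl ?moments //; try exact: measurable_itv;
  try (apply: continuous_integrable => //; exact: cN).
Qed.

(** Half-lines generate the Borel sets and are closed under intersection, and on
    them both weighted measures are limits of integrals of the same
    polynomials. *)
Theorem moments_determine_density D : measurable D ->
  (\int[m1]_(x in D) (w1 x)%:E = \int[m2]_(x in D) (w2 x)%:E)%E.
Proof.
pose dens m w cw w0 := @density_measure _ _ R m w (continuous_measurable_fun cw) w0.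
apply: (@measure_unique _ R _ (@RGenOInfty.G R) (fun k => `](- k%:R), +oo[%classic)
  _ _ _ _ (dens m1 w1 cw1 w1_ge0) (dens m2 w2 cw2 w2_ge0)).
- exact: RGenOInfty.measurableE.
- move=> _ _ [x ->] [y ->]; exists (Num.max x y); apply/seteqP; split => z /=;
    by rewrite !in_itv /= !andbT gt_max => /andP.
- by move=> i; exists (- i%:R).
- apply/seteqP; split => // x _; exists (Num.truncn `|x|).+1 => //=.
  rewrite in_itv /= andbT ltrNl; apply: le_lt_trans (ler_norm _) _.
  by rewrite normrN truncnS_gt.
- move=> _ [t ->].
  have mt : measurable (`]t, +oo[%classic : set R) by exact: measurable_itv.
  rewrite -[LHS]fineK -1?[RHS]fineK ?ge0_fin_numE //; first last.
  + exact: (@density_measure_finite R m1 w1 M fin1 m1K cw1 w1_ge0 _ mt).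
  + exact: (@density_measure_finite R m2 w2 M fin2 m2K cw2 w2_ge0 _ mt).
  congr EFin.
  have h1 := @step_at_integral_cvg R m1 w1 M M0 fin1 m1K cw1 w1_ge0 t.
  have h2 := @step_at_integral_cvg R m2 w2 M M0 fin2 m2K cw2 w2_ge0 t.
  apply: (cvg_unique (@Rhausdorff R) h1); apply: cvg_trans h2.
  apply: near_eq_cvg; apply: nearW => n /=; exact/esym/weighted_poly_integral.
- by move=> k; apply: (@density_measure_finite R m1 w1 M fin1 m1K cw1 w1_ge0).
Qed.

End MomentUniqueness.

(** * Conditionally positive definite sequences *)

Section CPDRepresentation.
Set Implicit Arguments.
Unset Strict Implicit.
Variable R : realType.
Implicit Types (mu nu : {finite_measure set R -> \bar R}) (u v : nat -> R).

(** Beyond the degree the truncated subtraction vanishes, so that one formula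
    gives all the coefficients. *)
Lemma coefQ n j : (Q R n)`_j = (n - j - 1)%N%:R.
Proof.
rewrite /Q coef_poly; case: ltnP => // h.
by have -> : (n - j - 1 = 0)%N by lia.
Qed.

Lemma Q_second_difference n : Q R n.+2 - 2 *: Q R n.+1 + Q R n = 'X^n.
Proof.
apply/polyP => j; rewrite coefD coefB coefZ !coefQ coefXn.
case: (ltngtP j n) => h.
- have -> : (n.+2 - j - 1 = (n - j - 1).+2)%N by lia.
  have -> : (n.+1 - j - 1 = (n - j - 1).+1)%N by lia.
  by rewrite mulr0n -[in LHS]natr1 -[in LHS]natr1; move: (_%:R : R) => a; ring.
- have -> : (n.+2 - j - 1 = 0)%N by lia.
  have -> : (n.+1 - j - 1 = 0)%N by lia.
  have -> : (n - j - 1 = 0)%N by lia.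
  by rewrite mulr0 subr0 addr0.
- rewrite h; have -> : (n.+2 - n - 1 = 1)%N by lia.
  have -> : (n.+1 - n - 1 = 0)%N by lia.
  have -> : (n - n - 1 = 0)%N by lia.
  by rewrite mulr0 subr0 addr0.
Qed.

Lemma Q_horner_ge0 n x : 0 <= x -> 0 <= (Q R n).[x].
Proof.
move=> x0; rewrite horner_coef; apply: sumr_ge0 => i _.
by rewrite coefQ mulr_ge0 ?ler0n ?exprn_ge0.
Qed.

Lemma Q1E : Q R 1 = 0.
Proof. by apply/polyP => j; rewrite coefQ coef0; case: j. Qed.

Lemma compact_support_segment mu : compactly_supported mu ->
  exists M : R, forall N : R, M <= N -> mu (~` `[0, N]) = 0%E.
Proof.
case=> K [cK KR K0]; have [M [Mr hM]] := compact_bounded cK.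
exists (M + 1) => N MN; apply: (subset_measure0 _ _ _ K0).
- by apply: measurableC; exact: measurable_itv.
- by apply: measurableC; apply: closed_measurable; apply: compact_closed.
- move=> x /= xN Kx; apply: xN; rewrite in_itv /=.
  have := KR _ Kx; rewrite /Rplus /= in_itv /= andbT => -> /=.
  apply: le_trans (ler_norm _) _; apply: hM => //.
  by apply: lt_le_trans MN; rewrite ltrDl.
Qed.

(** The defining formula normalized at u 0 instead of 1, as needed for the
    sequences ||W^n h||^2 with h of arbitrary norm. *)
Record cpd_representation u (b c : R) mu : Prop := {
  cr_ge0 : 0 <= c;
  cr_support : compactly_supported mu;
  cr_one : mu [set 1] = 0%E;
  cr_formula : forall n,
    u n = u 0%N + b * n%:R + c * n%:R ^+ 2 + \int[mu]_(x in @Rplus R) (Q R n).[x] }.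

Section Moments.
Variables (mu : {finite_measure set R -> \bar R}) (M : R).
Hypothesis muM : mu (~` `[0, M]) = 0%E.

Let mufin : (mu setT < +oo)%E.
Proof. by rewrite -ge0_fin_numE // fin_num_measure. Qed.

Lemma Rintegral_Rplus (f : R -> R) : continuous f ->
  \int[mu]_(x in @Rplus R) f x = \int[mu]_(x in `[0, M]) f x.
Proof.
move=> cf; apply: Rintegral_supported => //; first exact: measurable_itv.
by move=> x /=; rewrite /Rplus /= !in_itv /= andbT => /andP[].
Qed.

Lemma segment_integrable (f : R -> R) :
  continuous f -> mu.-integrable `[0, M] (EFin \o f).
Proof. exact: continuous_integrable. Qed.

(** The right-hand side is the n-th moment of mu + 2 c delta_1. *)
Lemma second_difference_moment u b c n : cpd_representation u b c mu ->
  u n.+2 - 2 * u n.+1 + u n = c * 2 + \int[mu]_(x in `[0, M]) x ^+ n.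
Proof.
case=> _ _ _ uE; have -> : \int[mu]_(x in `[0, M]) x ^+ n =
    \int[mu]_(x in `[0, M]) (Q R n.+2).[x] - 2 * \int[mu]_(x in `[0, M]) (Q R n.+1).[x]
    + \int[mu]_(x in `[0, M]) (Q R n).[x].
  have cQ k : continuous (fun x : R => (Q R k).[x]) by exact: continuous_horner.
  have c2Q k : continuous (fun x : R => 2 * (Q R k).[x]).
    by move=> x; apply: cvgMl_tmp; exact: cQ.
  have cB : continuous (fun x : R => (Q R n.+2).[x] - 2 * (Q R n.+1).[x]).
    by move=> x; apply: cvgB; [exact: cQ | exact: c2Q].
  rewrite -RintegralZl //; last exact: segment_integrable.
  rewrite -RintegralB //; do ?exact: segment_integrable.
  rewrite -RintegralD //; do ?exact: segment_integrable.
  by apply: eq_Rintegral => x _; rewrite -hornerXn -Q_second_difference !hornerE.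
rewrite (uE n.+2) (uE n.+1) (uE n) !Rintegral_Rplus; do ?exact: continuous_horner.
by rewrite -!natr1; ring.
Qed.

(** The atom is put at 1, where all the powers of x equal 1, so that it absorbs
    the quadratic term of a cpd_representation into the moments. *)
Definition with_atom (a : {nonneg R}) : {measure set R -> \bar R} :=
  measure_add mu (mscale a (\d_(1%R : R))).

Lemma with_atomE a D : with_atom a D = (mu D + a%:num%:E * \d_(1%R : R) D)%E.
Proof. exact: measure_addE. Qed.

Lemma with_atom_finite a : (with_atom a setT < +oo)%E.
Proof.
by rewrite with_atomE diracT mule1 lte_add_pinfty // ltry.
Qed.

Lemma with_atom_supported a : 1 <= M -> with_atom a (~` `[0, M]) = 0%E.
Proof.
move=> M1; rewrite with_atomE muM add0e diracE memNset ?mule0 //= => h.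
by apply: h; rewrite in_itv /= ler01.
Qed.

Lemma integral_with_atom a D (f : R -> R) : measurable D -> continuous f ->
  (forall x, D x -> 0 <= f x) ->
  (\int[with_atom a]_(x in D) (f x)%:E =
   \int[mu]_(x in D) (f x)%:E + a%:num%:E * (\d_(1%R : R) D * (f 1%R)%:E))%E.
Proof.
move=> mD cf f0.
have mf : measurable_fun D (EFin \o f).
  by apply/measurable_EFinP; apply: measurable_funTS; exact: continuous_measurable_fun.
rewrite /with_atom ge0_integral_measure_add //.
by rewrite ge0_integral_mscale // integral_dirac.
Qed.

Lemma Rintegral_with_atom a (f : R -> R) : 1 <= M -> continuous f ->
  (forall x, 0 <= x -> 0 <= f x) ->
  \int[with_atom a]_(x in `[0, M]) f x =
   \int[mu]_(x in `[0, M]) f x + a%:num * f 1.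
Proof.
move=> M1 cf f0; rewrite /Rintegral integral_with_atom //; last first.
  by move=> x /=; rewrite in_itv /= => /andP[+ _]; exact: f0.
rewrite diracE mem_set /=; last by rewrite in_itv /= ler01.
rewrite mul1e fineD //; apply: integrable_fin_num => //.
exact: segment_integrable.
Qed.

End Moments.

(** The data of a multiple of a shifted sequence.  Shifting by k multiplies the
    moment measure by x^k, which does not change the atom at 1.  The case k = 0,
    s = 1 is the uniqueness of the data. *)
Lemma cpd_representation_shift u v b c mu b' c' nu (s : R) k : 0 <= s ->
  cpd_representation u b c mu -> cpd_representation v b' c' nu ->
  (forall n, u n = s * v (n + k)%N) ->
  [/\ c = s * c', b = s * (v k.+1 - v k - c') &
      forall D, measurable D -> D `<=` @Rplus R ->
        fine (mu D) = s * \int[nu]_(x in D) x ^+ k].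
Proof.
move=> s0 ru rv uv.
have [M1 hM1] := compact_support_segment (cr_support ru).
have [M2 hM2] := compact_support_segment (cr_support rv).
pose M := Num.max 1 (Num.max M1 M2).
have M1' : 1 <= M by rewrite le_max lexx.
have M0 : 0 <= M := le_trans ler01 M1'.
have muM : mu (~` `[0, M]) = 0%E by apply: hM1; rewrite !le_max lexx orbT.
have nuM : nu (~` `[0, M]) = 0%E by apply: hM2; rewrite !le_max lexx !orbT.
have c20 : 0 <= c * 2 by rewrite mulr_ge0 // (cr_ge0 ru).
have c20' : 0 <= c' * 2 by rewrite mulr_ge0 // (cr_ge0 rv).
(* The absolute value makes the weight nonnegative off the half-line, where the
   measures vanish. *)
pose w (x : R) : R := s * `|x ^+ k|.
have w0 x : 0 <= w x by rewrite mulr_ge0.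
have cw : continuous w.
  move=> x; apply: cvgMl_tmp.
  by apply: cvg_norm; exact: exprn_continuous.
have c1 : continuous (fun _ : R => 1 : R) by move=> x; exact: cvg_cst.
have one0 x : 0 <= (fun _ : R => 1 : R) x by [].
have mom n : \int[with_atom mu (NngNum c20)]_(x in `[0, M]) (x ^+ n * 1) =
             \int[with_atom nu (NngNum c20')]_(x in `[0, M]) (x ^+ n * w x).
  have cX m : continuous (fun x : R => x ^+ m) by exact: exprn_continuous.
  rewrite !Rintegral_with_atom //; first last.
  - by move=> x x0; rewrite mulr1 exprn_ge0.
  - by move=> x; apply: cvgM; [exact: cX | exact: c1].
  - by move=> x x0; rewrite mulr_ge0 // exprn_ge0.
  - by move=> x; apply: cvgM; [exact: cX | exact: cw].
  under eq_Rintegral do rewrite mulr1.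
  under [in RHS]eq_Rintegral => x.
    rewrite inE /= in_itv /= => /andP[x0 _].
    rewrite /w normrX (ger0_norm x0) mulrCA -exprD; over.
  rewrite RintegralZl //; last exact: segment_integrable.
  have := second_difference_moment muM n ru.
  rewrite !uv !addSn => hu.
  have := second_difference_moment nuM (n + k) rv => hv.
  rewrite /= /w !expr1n normr1 !mulr1 addrC -hu.
  transitivity (s * (v (n + k).+2 - 2 * v (n + k).+1 + v (n + k)%N)); first by ring.
  by rewrite hv mul1r mulrDr addrC [s * (_ * _)]mulrC.
have key D : measurable D ->
    (mu D + (c * 2)%:E * \d_(1%R : R) D =
     \int[nu]_(x in D) (w x)%:E + (c' * 2)%:E * (\d_(1%R : R) D * (w 1%R)%:E))%E.
  move=> mD.
  have := moments_determine_density M0 (with_atom_finite _ _) (with_atom_finite _ _)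
    (with_atom_supported muM _ M1') (with_atom_supported nuM _ M1')
    c1 cw one0 w0 mom mD.
  by rewrite integral_cst // mul1e with_atomE integral_with_atom.
(* Neither mu nor nu charges the point 1, so only the atoms remain there. *)
have cE : c = s * c'.
  have := key _ (measurable_set1 1).
  rewrite (cr_one ru) diracE mem_set //= mule1 mul1e add0e.
  rewrite (null_set_integral _ _ (cr_one rv)) //; last first.
    by apply/measurable_EFinP; apply: measurable_funTS; exact: continuous_measurable_fun.
  rewrite add0e /w expr1n normr1 mulr1 => -[h].
  by apply: (@mulIf _ 2) => //; rewrite h; ring.
split=> //.
- have h0 := cr_formula rv; have h := cr_formula ru 1%N.
  rewrite Q1E in h; move: h; under eq_Rintegral do rewrite horner0.
  rewrite Rintegral_cst ?mul0r; last exact: measurable_itv.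
  by rewrite !uv add0n add1n cE => h; rewrite !mulrBr h; ring.
- move=> D mD DR; have := key D mD.
  rewrite diracE -!EFinM cE.
  have -> : (s * c' * 2 * (1%R \in D)%:R = c' * 2 * ((1%R \in D)%:R * w 1) :> R).
    by rewrite /w expr1n normr1; ring.
  move=> /(congr1 (fun z => (z - (c' * 2 * ((1%R \in D)%:R * w 1))%:E)%E)).
  rewrite !addeK // => h.
  rewrite h -[LHS]/(\int[nu]_(x in D) w x).
  rewrite -RintegralZl //.
    apply: eq_Rintegral => x /[!inE] Dx; rewrite /w normrX ger0_norm //.
    by have := DR _ Dx; rewrite /Rplus /= in_itv /= andbT.
  apply: (integrable_supported _ nuM) => //.
  - by rewrite -ge0_fin_numE // fin_num_measure.
  - exact: exprn_continuous.
Qed.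

End CPDRepresentation.

(** * Quadratic forms and the weighted shift *)

Section QuadraticForms.
Set Implicit Arguments.
Unset Strict Implicit.
Variable R : realType.
Local Notation H := (ell2 R).
Local Notation e := (l2basis R).
Implicit Types (h g : H) (T A : H -> H).

Lemma ell2_ext h g : (forall k, h k = g k) -> h = g.
Proof. by move=> hg; apply/val_inj/funext. Qed.

Lemma ell2Z (a : R[i]) h k : (a *: h : H) k = a * h k. Proof. by []. Qed.

Lemma series_indic (f : nat -> R) k : (forall n, n != k -> f n = 0) ->
  limn (series f) = f k.
Proof.
move=> f0; apply: cvg_lim => //; apply: (@cvg_near_cst _ _ _ _ _).
exists k.+1 => // n /= kn; rewrite /series /= (bigD1_seq k) ?iota_uniq //=.
  by rewrite big1 ?addr0 // => i /f0.
by rewrite mem_index_iota.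
Qed.

Lemma dot_basis h k : dot h (e k) = h k.
Proof.
have hE n : h n * ((e k : H) n)^*%C = if n == k then h k else 0.
  rewrite -[X in _ * X^*%C]/((n == k)%:R); case: eqP => [->|_].
    by rewrite [X in _ * X](_ : _ = 1) ?mulr1 // /= oppr0.
  by rewrite [X in _ * X](_ : _ = 0) ?mulr0 // /= oppr0.
rewrite /dot /csum; apply/eqP; rewrite eq_complex /=; apply/andP; split; apply/eqP.
  rewrite (@series_indic _ k) => [|n /negbTE nk]; by rewrite hE ?eqxx // nk.
rewrite (@series_indic _ k) => [|n /negbTE nk]; by rewrite hE ?eqxx // nk.
Qed.

Lemma dotDr h g1 g2 : dot h (g1 + g2) = dot h g1 + dot h g2.
Proof. by rewrite dotC dotDl [dot h g1]dotC [dot h g2]dotC; exact: rmorphD. Qed.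

Lemma dotZr (a : R[i]) h g : dot h (a *: g) = a^*%C * dot h g.
Proof. by rewrite dotC dotZl [dot h g]dotC; exact: rmorphM. Qed.

Lemma l2norm_basis k : l2norm (e k) = 1.
Proof.
have := dot_l2norm (e k); rewrite dot_basis.
rewrite -[LHS]/((k == k)%:R) eqxx => -[/esym/eqP].
by rewrite sqrp_eq1 ?l2norm_ge0 // => /eqP.
Qed.

Lemma quad_expand T h g (z : R[i]) : linear T ->
  dot (T (h + z *: g)) (h + z *: g) =
  dot (T h) h + z^*%C * dot (T h) g + z * dot (T g) h + z * z^*%C * dot (T g) g.
Proof.
move=> lT; rewrite addrC lT !dotDl !dotDr !dotZl !dotZr; ring.
Qed.

(** For z = 1 and z = i the hypothesis says that <T h, g> + <T g, h> = 0 and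
    <T h, g> - <T g, h> = 0. *)
Lemma form_eq0 T h g : linear T ->
  (forall z : R[i], dot (T (h + z *: g)) (h + z *: g) =
                    dot (T (h + (- z) *: g)) (h + (- z) *: g)) ->
  dot (T h) g = 0.
Proof.
move=> lT hq; have := hq 1; have := hq 'i; rewrite !quad_expand //.
case: (dot (T h) h) (dot (T g) g) (dot (T h) g) (dot (T g) h)
  => [p1 p2] [q1 q2] [a1 a2] [b1 b2] [h1 h2] [h3 h4].
by apply/eqP; rewrite eq_complex /=; apply/andP; split; apply/eqP; lra.
Qed.

(** A positive operator on a complex space is self-adjoint: the imaginary parts
    of its form at h + g and h + i g vanish. *)
Lemma positive_hermitian T h g : linear T -> positive_operator T ->
  dot (T h) g = (dot (T g) h)^*%C.
Proof.
move=> lT pT; have im0 f : complex.Im (dot (T f) f) = 0.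
  by have := pT f; rewrite lecE /= => /andP[/eqP <-].
have := im0 (h + 'i *: g); have := im0 (h + 1 *: g); rewrite !quad_expand //.
have := im0 h; have := im0 g.
case: (dot (T h) h) (dot (T g) g) (dot (T h) g) (dot (T g) h)
  => [p1 p2] [q1 q2] [a1 a2] [b1 b2] /= h1 h2 h3 h4.
by apply/eqP; rewrite eq_complex /=; apply/andP; split; apply/eqP; lra.
Qed.

Lemma diagonal_basis T k (x : R[i]) :
  (forall j, j != k -> dot (T (e k)) (e j) = 0) ->
  dot (T (e k)) (e k) = x -> T (e k) = x *: e k.
Proof.
move=> off on; apply: ell2_ext => j; rewrite ell2Z.
rewrite -[X in _ = _ * X]/((j == k)%:R) -dot_basis.
by case: eqP => [->|/eqP /off ->]; rewrite ?mulr1 // mulr0.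
Qed.

Lemma adjoint_iter T S n h g : is_adjoint T S ->
  dot (iter n S h) g = dot h (iter n T g).
Proof.
move=> [_ TS]; elim: n h g => // n ih h g.
by rewrite iterS dotC -TS -dotC ih iterSr.
Qed.

Lemma quad_measure_null F h (mu : {finite_measure set R -> \bar R}) D :
  measurable D -> quad_measure F h mu -> F D h = 0 -> mu D = 0%E.
Proof.
move=> mD qm F0; have := qm D mD; rewrite F0 -(scale0r h) dotZl mul0r => -[h0].
by rewrite -[LHS]fineK ?fin_num_measure // -h0.
Qed.

Section Shift.
Variables (lambda : nat -> R) (lb : exists M : R, forall n, `|lambda n| <= M).
Hypothesis lambda_gt0 : forall n, 0 < lambda n.
Local Notation W := (wshift lb).
Local Notation lhat := (lambda_hat lambda).

Lemma lambda_hat_gt0 n : 0 < lhat n.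
Proof. by apply: prodr_gt0 => i _; rewrite exprn_gt0. Qed.

Lemma wshiftZ (a : R[i]) h : W (a *: h) = a *: W h.
Proof.
apply: ell2_ext => -[|n]; rewrite ell2Z /= ?mulr0 //.
by rewrite -[X in _ * X]/(a * h n) mulrCA.
Qed.

Lemma sqnorm_iter_wshift_basis n k :
  l2norm (iter n W (e k)) ^+ 2 = (lhat k)^-1 * lhat (n + k)%N.
Proof.
suff [a [-> ->]] : exists a : R, iter n W (e k) = a%:C *: e (n + k)%N /\
    (lhat k)^-1 * lhat (n + k)%N = a ^+ 2.
  rewrite l2normZ l2norm_basis mulr1 /= expr0n addr0 sqrtr_sqr.
  by rewrite real_normK ?num_real.
elim: n => [|n [a [ih1 ih2]]].
  exists 1; split; first by rewrite scale1r.
  by rewrite mulVf ?expr1n // gt_eqF // lambda_hat_gt0.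
exists (lambda (n + k)%N * a); rewrite iterS ih1 wshiftZ wshift_basis; split.
  by rewrite scalerA -rmorphM mulrC.
by rewrite addSn /lambda_hat big_ord_recr /= mulrA ih2; ring.
Qed.

Lemma l2norm_modulus h g : (forall k, Normc.normc (h k) = Normc.normc (g k)) ->
  l2norm h = l2norm g.
Proof.
move=> hg; rewrite /l2norm; congr (Num.sqrt (limn (series _))).
by apply/funext => k; rewrite /sqnorms hg.
Qed.

(** The shift multiplies each coordinate by a number that does not depend on the
    vector, so equality of moduli is preserved by every step. *)
Lemma l2norm_iter_wshift_modulus n h g :
  (forall k, Normc.normc (h k) = Normc.normc (g k)) ->
  l2norm (iter n W h) = l2norm (iter n W g).
Proof.
elim: n h g => [|n ih] h g hg; first exact: l2norm_modulus.
rewrite !iterSr; apply: ih => -[|k] //=.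
by rewrite !Normc.normcM hg.
Qed.

Variables (B C : H -> H) (F : set R -> H -> H).
Hypothesis triplet : representing_triplet W B C F.

Lemma quad_measureP h : exists mu, quad_measure F h mu.
Proof. by have [_ + _] := rt_semispectral triplet; apply. Qed.

Lemma dot_real (z : R[i]) : 0 <= z -> z = (complex.Re z)%:C.
Proof. by case: z => a b; rewrite lecE /= => /andP[/eqP -> _]. Qed.

Lemma dot_CE h : dot (C h) h = (complex.Re (dot (C h) h))%:C.
Proof. exact/dot_real/(rt_positive_C triplet). Qed.

Lemma dot_BE h : dot (B h) h = (complex.Re (dot (B h) h))%:C.
Proof.
have [_ adj] := rt_selfadjoint_B triplet.
have := adj h h; rewrite [RHS]dotC; case: (dot _ _) => a b [hb].
by congr (_ +i* _); lra.
Qed.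

(** Pair the formula for the n-th power with h and move the powers of the adjoint
    to the other side. *)
Lemma quad_cpd_representation h mu : quad_measure F h mu ->
  cpd_representation (fun n => l2norm (iter n W h) ^+ 2)
    (complex.Re (dot (B h) h)) (complex.Re (dot (C h) h)) mu.
Proof.
move=> qm; split.
- by have := rt_positive_C triplet h; rewrite dot_CE lecR.
- have [K [cK KR FK]] := rt_support triplet; exists K; split=> //.
  apply: (quad_measure_null _ qm) => //; apply: measurableC.
  by apply: closed_measurable; exact: compact_closed.
- exact: (quad_measure_null _ qm (rt_one triplet h)).
- move=> n; have [S adj formula] := rt_formula triplet.
  have [A [_ Aint] AE] := formula n.
  have := congr1 (fun f => dot f h) (AE h).
  rewrite (adjoint_iter _ _ _ adj) !dotDl !dotZl !dot_l2norm (Aint _ _ qm).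
  rewrite dot_BE dot_CE -!(rmorph_nat (real_complex R)) -!rmorphM -!rmorphD.
  move=> /complexI -> /=; rewrite natrX; ring.
Qed.

(** Both vectors give the same sequence of norms, hence the same data. *)
Lemma equal_modulus_equal_forms h g :
  (forall k, Normc.normc (h k) = Normc.normc (g k)) ->
  [/\ dot (B h) h = dot (B g) g, dot (C h) h = dot (C g) g &
      forall D, measurable D -> D `<=` @Rplus R -> dot (F D h) h = dot (F D g) g].
Proof.
move=> modulus.
have [mh qh] := quad_measureP h; have [mg qg] := quad_measureP g.
have rh := quad_cpd_representation qh; have rg := quad_cpd_representation qg.
have hg n : l2norm (iter n W h) ^+ 2 = 1 * l2norm (iter (n + 0) W g) ^+ 2.
  by rewrite mul1r addn0 (l2norm_iter_wshift_modulus _ modulus).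
have gg n : l2norm (iter n W g) ^+ 2 = 1 * l2norm (iter (n + 0) W g) ^+ 2.
  by rewrite mul1r addn0.
have [ch bh Fh] := cpd_representation_shift ler01 rh rg hg.
have [_ bg Fg] := cpd_representation_shift ler01 rg rg gg.
split.
- by rewrite (dot_BE h) (dot_BE g) bh -bg.
- by rewrite (dot_CE h) (dot_CE g) ch mul1r.
- by move=> D mD DR; rewrite (qh D mD) (qg D mD) Fh // Fg.
Qed.

End Shift.
End QuadraticForms.

(** * Compactness of Hilbert cubes *)

Section HilbertCube.
Set Implicit Arguments.
Unset Strict Implicit.
Variable R : realType.
Local Notation H := (ell2 R).

(** An ultrafilter converges to any of its cluster points, and a segment has
    one. *)
Lemma ultra_bounded_cvg (T : Type) (F : set_system T) (f : T -> R) (a : R) :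
  UltraFilter F -> F [set x | `|f x| <= a] ->
  exists2 l, `|l| <= a & f x @[x --> F] --> l.
Proof.
move=> FU Fa; have Pf : ProperFilter F by exact: ultra_proper.
have [|l [/= al cl]] := @segment_compact R (- a) a (f @ F) _.
  by apply: (@filterS _ F _ _ (f @^-1` _) _ Fa) => x /=; rewrite in_itv /= -ler_norml.
exists l; first by rewrite ler_norml; move: al; rewrite /= in_itv.
move=> A Al; have [//|FnA] := in_ultra_setVsetC (f @^-1` A) FU.
by have [x []] := cl (~` A) A FnA Al.
Qed.

(** Real and imaginary parts are bounded separately, so that each real coordinate
    ranges over a segment. *)
Definition hilbert_cube (d : nat -> R) : set H :=
  [set h | forall k, `|complex.Re (h k)| <= d k /\ `|complex.Im (h k)| <= d k].

Lemma normc_sqr (z : R[i]) :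
  Normc.normc z ^+ 2 = complex.Re z ^+ 2 + complex.Im z ^+ 2.
Proof. by case: z => a b /=; rewrite sqr_sqrtr ?addr_ge0 ?sqr_ge0. Qed.

Lemma norm_le_sqr (x a : R) : `|x| <= a -> x ^+ 2 <= a ^+ 2.
Proof.
move=> xa; rewrite -real_normK ?num_real // lerXn2r // nnegrE //.
exact: le_trans xa.
Qed.

Lemma series_ge0_le (f : nat -> R) m n : (forall k, 0 <= f k) -> (m <= n)%N ->
  series f m <= series f n.
Proof. by move=> f0; apply: nondecreasing_series => k _ _; exact: f0. Qed.

(** Along an ultrafilter every coordinate converges.  The limits form a point of
    the cube, and convergence to it is in norm because the tails of all points
    of the cube are bounded uniformly by the tail of the series of d k ^ 2. *)
Lemma hilbert_cube_compact (d : nat -> R) :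
  cvgn (series (fun k => d k ^+ 2)) -> compact (hilbert_cube d).
Proof.
move=> cd; rewrite compact_ultra => F FU Fcube.
have Pf : ProperFilter F by exact: ultra_proper.
have /choice[l hl] : forall k, exists l : R,
    `|l| <= d k /\ complex.Re ((h : H) k) @[h --> F] --> l.
  move=> k; have [|l] := @ultra_bounded_cvg _ F (fun h : H => complex.Re (h k)) (d k) FU.
    by apply: (filterS _ Fcube) => h /(_ k)[].
  by exists l.
have /choice[m hm] : forall k, exists l : R,
    `|l| <= d k /\ complex.Im ((h : H) k) @[h --> F] --> l.
  move=> k; have [|l'] := @ultra_bounded_cvg _ F (fun h : H => complex.Im (h k)) (d k) FU.
    by apply: (filterS _ Fcube) => h /(_ k)[].
  by exists l'.
set sd := series (fun k => d k ^+ 2) in cd.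
have d2 k : 0 <= d k ^+ 2 by exact: sqr_ge0.
have sdle n : sd n <= limn sd.
  by apply: nondecreasing_cvgn_le => // a b; exact: series_ge0_le.
have gs : (fun k => l k +i* m k) \in @square_summable R.
  apply: (@square_summableP _ _ (2 * limn sd)) => n.
  apply: (@le_trans _ _ (2 * sd n)); last by rewrite ler_pM2l.
  rewrite /sd /series /= mulr_sumr; apply: ler_sum => k _.
  rewrite /sqnorms normc_sqr /= mulr2n mulrDl mul1r.
  by apply: lerD; apply: norm_le_sqr; [case: (hl k) | case: (hm k)].
pose g : H := Ell2 gs.
have gcube : hilbert_cube d g by move=> k; split; [case: (hl k) | case: (hm k)].
exists g; split=> // A /nbhs_ballP[eps eps0 epsA].
have [r r0 repsE] : exists2 r : R, 0 < r & eps = r%:C.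
  case: eps eps0 {epsA} => a b /=; rewrite ltcE /= => /andP[/eqP -> a0].
  by exists a.
pose eta := r ^+ 2 / 4.
have eta0 : 0 < eta by rewrite divr_gt0 // exprn_gt0.
have [N tailN] : exists N, 8 * (limn sd - sd N) < eta.
  have : sd n @[n --> \oo] --> limn sd by [].
  move=> /cvgrPdist_lt /(_ (eta / 8)); rewrite divr_gt0 // => /(_ isT)[N _ hN].
  exists N; have := hN N (leqnn N); rewrite /= ger0_norm ?subr_ge0 //.
  by rewrite ltr_pdivlMr // mulrC.
(* Each of the two parts of g k - h k is at most 2 d k, whence 4 + 4 = 8. *)
have tail h n : hilbert_cube d h ->
    series (sqnorms (g - h)) n <= series (sqnorms (g - h)) N + 8 * (limn sd - sd N).
  move=> hc; have := series_ge0_le (sqnorms_ge0 (g - h)) => smono.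
  have sub0 : 0 <= 8 * (limn sd - sd N) by rewrite mulr_ge0 // subr_ge0.
  have [nN|/ltnW Nn] := leqP n N.
    by apply: le_trans (smono _ _ nN) _; rewrite lerDl.
  have E f : series f n = series f N + \sum_(N <= k < n) f k :> R.
    by rewrite /series /= (big_cat_nat (n := N)).
  rewrite E lerD2l; apply: (@le_trans _ _ (8 * (sd n - sd N))); last first.
    by rewrite ler_pM2l // lerD2r.
  rewrite {1}/sd (E (fun k => d k ^+ 2)) -/sd addrAC subrr add0r mulr_sumr.
  apply: ler_sum => k _; rewrite /sqnorms normc_sqr.
  have [gr gi] := gcube k; have [hr hi] := hc k.
  have bnd (x y : R) : `|x| <= d k -> `|y| <= d k -> (x - y) ^+ 2 <= 4 * d k ^+ 2.
    move=> hx hy; have -> : 4 * d k ^+ 2 = (d k + d k) ^+ 2 by ring.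
    apply: norm_le_sqr; apply: le_trans (ler_normB _ _) _; exact: lerD.
  have := bnd _ _ gr hr; have := bnd _ _ gi hi.
  rewrite -[((g - h) k : R[i])]/(g k - h k).
  case: (g k) (h k) => a b [a' b'] /=; lra.
have sq (f : H -> R) (a : R) : f h @[h --> F] --> a ->
    (a - f h) * (a - f h) @[h --> F] --> (0 : R).
  move=> fa; have h0 : a - f h @[h --> F] --> a - a.
    by apply: cvgB => //; exact: cvg_cst.
  by have := cvgM h0 h0; rewrite subrr mulr0; apply.
have term n : sqnorms (g - (h : H)) n @[h --> F] --> (0 : R).
  rewrite (_ : (fun h : H => _) = fun h : H =>
      (l n - complex.Re (h n)) * (l n - complex.Re (h n)) +
      (m n - complex.Im (h n)) * (m n - complex.Im (h n))).
    by have := cvgD (sq _ _ (proj2 (hl n))) (sq _ _ (proj2 (hm n))); rewrite addr0; apply.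
  apply/funext => h; rewrite /sqnorms normc_sqr -[((g - h) n : R[i])]/(g n - h n).
  by rewrite -[g n]/(l n +i* m n); case: (h n) => u v; rewrite !expr2.
have head : series (sqnorms (g - (h : H))) N @[h --> F] --> (0 : R).
  elim: N {tailN tail} => [|n ih].
    rewrite (_ : (fun h => _) = cst 0); first exact: cvg_cst.
    by apply/funext => h; rewrite /series /= big_geq.
  rewrite (_ : (fun h : H => _) = fun h : H =>
      series (sqnorms (g - h)) n + sqnorms (g - h) n).
    by have := cvgD ih (term n); rewrite addr0; apply.
  by apply/funext => h; rewrite seriesSr.
move/cvgrPdist_lt : head => /(_ _ eta0) head.
rewrite nbhs_filterE.
apply: filterS2 Fcube head => h hc /=; rewrite sub0r normrN ger0_norm; last first.
  by apply: sumr_ge0 => k _; exact: sqnorms_ge0.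
move=> hN; apply: epsA; rewrite -ball_normE /= l2normE repsE ltcR.
rewrite -(@ltr_pXn2r _ 2) ?nnegrE ?l2norm_ge0 ?(ltW r0) //.
rewrite l2norm_sqr; apply: (@le_lt_trans _ _ (eta + eta)); last first.
  have : 0 < r ^+ 2 by rewrite exprn_gt0.
  rewrite /eta; lra.
apply: limr_le; first exact/asboolP/ell2P.
apply: nearW => n; apply: le_trans (tail h n hc) _.
by apply: lerD; exact: ltW.
Qed.

End HilbertCube.

(** * Square summability of the diagonal terms *)

Section Growth.
Set Implicit Arguments.
Unset Strict Implicit.
Variable R : realType.

(** The quadratic dominates n + 1 from some rank on, and the finitely many
    remaining values are positive.  Linear growth is enough here: the inverses of
    the terms then have summable squares. *)
Lemma linear_lower_bound (v : nat -> R) (b c : R) : 0 < c ->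
  (forall n, 0 < v n) -> (forall n, 1 + b * n%:R + c * n%:R ^+ 2 <= v n) ->
  exists2 r, 0 < r & forall n, r * n.+1%:R <= v n.
Proof.
move=> c0 v0 vq.
(* Past (1 - b) / c, the excess n (c n + b - 1) over n + 1 is nonnegative. *)
pose N := (Num.truncn (`|1 - b| / c)).+1.
have large n : (N <= n)%N -> n.+1%:R <= v n.
  move=> Nn; apply: le_trans (vq n).
  have : `|1 - b| / c <= n%:R.
    by apply: ltW; apply: lt_le_trans (truncnS_gt _) _; rewrite ler_nat.
  rewrite ler_pdivrMr // => h.
  have {}h : 1 - b <= n%:R * c := le_trans (ler_norm _) h.
  have n0 : 0 <= n%:R :> R by [].
  have := ler_wpM2l n0 h; rewrite -natr1 expr2 => h2.
  rewrite -subr_ge0 in h2; rewrite -subr_ge0.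
  by apply: le_trans h2 _; rewrite le_eqVlt; apply/orP; left; apply/eqP; ring.
have [r /andP[r0 r1] small] : exists2 r, 0 < r <= 1 &
    forall n, (n < N)%N -> r * n.+1%:R <= v n.
  elim: N {large} => [|m [r /andP[r0 r1] hr]]; first by exists 1; rewrite ?ltr01 ?lexx.
  exists (Num.min r (v m / m.+1%:R)).
    by rewrite lt_min r0 divr_gt0 ?ltr0Sn //= ge_min r1.
  move=> n; rewrite ltnS leq_eqVlt => /predU1P[->|nm].
    by rewrite -ler_pdivlMr ?ltr0Sn // ge_min lexx orbT.
  apply: le_trans (hr n nm); rewrite ler_wpM2r // ge_min lexx //.
exists r => // n; have [nN|Nn] := ltnP n N; first exact: small.
by apply: le_trans (large n Nn); rewrite ler_piMl.
Qed.

(** The increment of the right-hand side, 1 / ((n + 1) (n + 2)), exceeds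
    1 / (n + 2)^2. *)
Lemma inverse_squares_le n :
  series (fun k => (k.+1%:R ^+ 2)^-1 : R) n.+1 <= 2 - n.+1%:R^-1.
Proof.
elim: n => [|n ih].
  rewrite seriesSr /series /= big_geq // add0r invr1 expr1n invr1; lra.
rewrite seriesSr; have {}ih := lerD ih (lexx (n.+2%:R ^+ 2)^-1).
apply: le_trans ih _.
have n1 : 0 < n.+1%:R :> R by rewrite ltr0Sn.
have n2 : 0 < n.+2%:R :> R by rewrite ltr0Sn.
have -> : n.+1%:R^-1 = (n.+2%:R ^+ 2)^-1 + n.+2%:R^-1 + (n.+1%:R * n.+2%:R ^+ 2)^-1 :> R.
  rewrite -(natr1 n.+1) in n2 *; field.
  by rewrite !gt_eqF.
have : 0 <= (n.+1%:R * n.+2%:R ^+ 2)^-1 :> R.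
  by rewrite invr_ge0 mulr_ge0 ?exprn_ge0 // ltW.
move: (_ * _)^-1 (_ ^+ 2)^-1 => p s p0.
by rewrite -subr_ge0 (_ : _ - _ = p) //; ring.
Qed.

Lemma square_summable_inverse (f : nat -> R) (K : R) : (forall n, 0 <= f n) ->
  (forall n, f n <= K / n.+1%:R) -> cvgn (series (fun n => f n ^+ 2)).
Proof.
move=> f0 fK; apply: nondecreasing_is_cvgn.
  by apply: nondecreasing_series => n _ _; exact: sqr_ge0.
exists (K ^+ 2 * 2) => _ [n _ <-].
apply: (@le_trans _ _ (K ^+ 2 * series (fun k => (k.+1%:R ^+ 2)^-1) n)).
  rewrite /series /= mulr_sumr; apply: ler_sum => k _.
  by rewrite -exprVn -exprMn lerXn2r ?nnegrE // (le_trans (f0 k)).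
rewrite ler_wpM2l ?sqr_ge0 //; case: n => [|n].
  by rewrite /series /= big_geq.
by apply: le_trans (inverse_squares_le n) _; rewrite gerBl invr_ge0.
Qed.

End Growth.

(** * Diagonal operators *)

Section Compactness.
Set Implicit Arguments.
Unset Strict Implicit.
Variable R : realType.
Local Notation H := (ell2 R).

(** Passing from the basis to all vectors needs no continuity: the operator is
    self-adjoint, so it can be moved onto the basis vector. *)
Lemma diagonal_coordinate (T : H -> H) (xi : nat -> R) h k : positive_operator T ->
  diagonal_operator T (fun k => (xi k)%:C) -> T h k = (xi k)%:C * h k.
Proof.
move=> pT [[lT _] dT]; rewrite -dot_basis (positive_hermitian _ _ lT pT) -dotC dT.
by rewrite dotZr dot_basis /= oppr0.
Qed.

(** The image of the unit ball lies in the Hilbert cube given by xi. *)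
Lemma diagonal_compact (T : H -> H) (xi : nat -> R) : positive_operator T ->
  (forall k, 0 <= xi k) -> cvgn (series (fun k => xi k ^+ 2)) ->
  diagonal_operator T (fun k => (xi k)%:C) -> compact_operator T.
Proof.
move=> pT xi0 sxi dT; split; first by case: dT.
have ccube := hilbert_cube_compact sxi.
apply: (subclosed_compact _ ccube); first exact: closed_closure.
have : closed (hilbert_cube xi) by apply: compact_closed ccube; exact: norm_hausdorff.
move=> /closure_id ->; apply: closureS => _ [h /= h1 <-] k.
have bnd : Normc.normc (T h k) <= xi k.
  rewrite (diagonal_coordinate _ _ pT dT) Normc.normcM.
  rewrite (_ : Normc.normc (xi k)%:C = xi k); last first.
    by rewrite /= expr0n addr0 sqrtr_sqr ger0_norm.
  rewrite ler_piMr //; apply: le_trans (normc_le_l2norm h k) _.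
  by move: h1; rewrite l2normE -(rmorph1 (real_complex R)) lecR.
by split; apply: le_trans bnd; [exact: Re_le_normc | exact: Im_le_normc].
Qed.

End Compactness.

Theorem theorem6p1 (R : realType) (lambda : nat -> R)
    (lambda_gt0 : forall n, 0 < lambda n)
    (lambda_bounded : exists M : R, forall n, `|lambda n| <= M)
    (b c : R) (nu : {finite_measure set R -> \bar R})
    (B C : ell2 R -> ell2 R) (F : set R -> ell2 R -> ell2 R)
    (W_CPD : CPD_operator (wshift lambda_bounded))
    (scalar_triplet : scalar_representing_triplet lambda b c nu)
    (triplet : representing_triplet (wshift lambda_bounded) B C F) :
  let lhat := lambda_hat lambda in
  [/\ diagonal_operator B
        (fun k => ((lhat k.+1 - lhat k - c) / lhat k)%:C),
      diagonal_operator C (fun k => (c / lhat k)%:C),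
      (forall D : set R, measurable D -> D `<=` @Rplus R ->
        diagonal_operator (F D)
          (fun k => ((lhat k)^-1 * \int[nu]_(x in D) (x ^+ k))%:C)) &
      compact_operator C].
Proof.
move=> lhat.
have bB := rt_bounded_B triplet; have bC := rt_bounded_C triplet.
have bF D : measurable D -> bounded_operator (F D).
  by have [+ _ _] := rt_semispectral triplet; apply.
have lhat_gt0 n : 0 < lhat n by exact: lambda_hat_gt0.
have lhat0 : lhat 0%N = 1 by rewrite /lhat /lambda_hat big_ord0.
have rep : cpd_representation lhat b c nu.
  case: scalar_triplet => c0 sn n1 form; split=> // n.
  by rewrite lhat0; exact: form.
have c0 : 0 <= c := cr_ge0 rep.
(* e_k + z e_j and e_k - z e_j differ by a sign in one coordinate, so their
   coordinates have the same moduli. *)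
have off k j : j != k ->
    [/\ dot (B (l2basis R k)) (l2basis R j) = 0,
        dot (C (l2basis R k)) (l2basis R j) = 0 &
        forall D, measurable D -> D `<=` @Rplus R ->
          dot (F D (l2basis R k)) (l2basis R j) = 0].
  move=> jk; suff key z : let h := l2basis R k + z *: l2basis R j in
      let g := l2basis R k + (- z) *: l2basis R j in
      [/\ dot (B h) h = dot (B g) g, dot (C h) h = dot (C g) g &
          forall D, measurable D -> D `<=` @Rplus R -> dot (F D h) h = dot (F D g) g].
    split; [apply: form_eq0 bB.1 _ => z | apply: form_eq0 bC.1 _ => z |
            move=> D mD DR; apply: form_eq0 (bF D mD).1 _ => z];
      by have [? ? kF] := key z; rewrite ?kF.
  move=> h g; apply: (equal_modulus_equal_forms triplet) => n.
  rewrite -[h n]/((n == k)%:R + z * (n == j)%:R).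
  rewrite -[g n]/((n == k)%:R + (- z) * (n == j)%:R).
  case: eqP => [->|_]; first by rewrite eq_sym (negbTE jk) !mulr0.
  by rewrite !add0r mulNr; case: (z * _) => x y /=; rewrite !sqrrN.
have on k : [/\ dot (B (l2basis R k)) (l2basis R k) =
                  ((lhat k.+1 - lhat k - c) / lhat k)%:C,
    dot (C (l2basis R k)) (l2basis R k) = (c / lhat k)%:C &
    forall D, measurable D -> D `<=` @Rplus R ->
      dot (F D (l2basis R k)) (l2basis R k) =
        ((lhat k)^-1 * \int[nu]_(x in D) (x ^+ k))%:C].
  have [m qm] := quad_measureP triplet (l2basis R k).
  have rk := quad_cpd_representation triplet qm.
  have s0 : 0 <= (lhat k)^-1 by rewrite invr_ge0 ltW.
  have [cE bE FE] := cpd_representation_shift s0 rk rep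
    (fun n => sqnorm_iter_wshift_basis lambda_bounded lambda_gt0 n k).
  split.
  - by rewrite (dot_BE triplet) bE mulrC.
  - by rewrite (dot_CE triplet) cE mulrC.
  - by move=> D mD DR; rewrite (qm D mD) FE.
have dC : diagonal_operator C (fun k => (c / lhat k)%:C).
  split=> // k; apply: diagonal_basis; last by case: (on k).
  by move=> j /off [].
split=> //.
- split=> // k; apply: diagonal_basis; last by case: (on k).
  by move=> j /off [].
- move=> D mD DR; split=> [|k]; first exact: bF.
  apply: diagonal_basis; last by case: (on k) => _ _; apply.
  by move=> j /off [_ _]; apply.
apply: (diagonal_compact (rt_positive_C triplet) _ _ dC) => [k|].
  by rewrite divr_ge0 // ltW.
have [K hK] : exists K : R, forall n, c / lhat n <= K / n.+1%:R.
  move: c0; rewrite le_eqVlt => /predU1P[<-|cpos].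
    by exists 0 => n; rewrite !mul0r.
  have [||r r0 hr] := @linear_lower_bound R lhat b c cpos.
  - by [].
  - move=> n; rewrite (cr_formula rep n) lhat0 lerDl; apply: Rintegral_ge0 => x.
    by rewrite /Rplus /= in_itv /= andbT; exact: Q_horner_ge0.
  exists (c / r) => n; rewrite -mulrA ler_wpM2l ?(ltW cpos) // -invfM.
  by rewrite lef_pV2 ?posrE ?mulr_gt0 ?ltr0Sn // hr.
apply: square_summable_inverse hK => n; by rewrite divr_ge0 // ltW.
Qed.
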